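(* Let $K$ be a field, $S=K[x_1,\ldots,x_n]$, and let $I=P_{F_1}\cdots P_{F_r}\subset S$ be a transversal polymatroidal ideal. Then $$\operatorname{depth} S/I=c(G_I)-1+n-\Bigl|\bigcup_{i=1}^r F_i\Bigr|,$$ where $c(G_I)$ denotes the number of connected components of the graph $G_I$.
   Context: For a non-empty subset $F\subset[n]=\{1,\ldots,n\}$, $P_F=(x_i : i\in F)$. A transversal polymatroidal ideal is an ideal of the form $I=P_{F_1}\cdots P_{F_r}$, where $r\ge1$ and $F_1,\ldots,F_r$ is a collection of non-empty, not necessarily distinct, subsets of $[n]$. $G_I$ is the graph with vertex set $\{1,\ldots,r\}$ in which, for $i\ne j$, $\{i,j\}$ is an edge if and only if $F_i\cap F_j\neq\emptyset$. Depth is with respect to the graded maximal ideal $(x_1,\ldots,x_n)$. *)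

(* Defs.v *)
From mathcomp Require Import all_boot all_order all_algebra.
From mathcomp Require Import mpoly.

Set Implicit Arguments.
Unset Strict Implicit.
Unset Printing Implicit Defensive.

Import GRing.Theory.
Local Open Scope ring_scope.

(* Ideals are Prop-valued predicates: membership in an ideal given by
   generators comes with no boolean test. *)
Section Ideals.

Variable R : comNzRingType.

Definition ideal_gen (G : R -> Prop) : R -> Prop := fun f =>
  exists2 s : seq (R * R),
    (forall p, p \in s -> G p.2) & f = \sum_(p <- s) p.1 * p.2.

Definition ideal_prod (r : nat) (I : 'I_r -> R -> Prop) : R -> Prop :=
  ideal_gen (fun f =>
    exists2 a : 'I_r -> R, (forall i, I i (a i)) & f = \prod_i a i).

(* The ideal I + (f). *)
Definition ideal_adj (I : R -> Prop) (f : R) : R -> Prop := fun g =>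
  exists a, I (g - a * f).

(* f is a nonzerodivisor on R/I. *)
Definition quot_nzd (I : R -> Prop) (f : R) : Prop :=
  forall g, I (f * g) -> I g.

(* s is an (R/I)-regular sequence: its i-th term is a nonzerodivisor on
   R/(I + (s_0, ..., s_(i-1))), and R/(I + (s)) is not the zero module. *)
Fixpoint quot_regular (I : R -> Prop) (s : seq R) : Prop :=
  if s is f :: s' then quot_nzd I f /\ quot_regular (ideal_adj I f) s'
  else ~ I 1.

(* The depth of R/I with respect to m is d: the greatest length of an
   (R/I)-regular sequence of elements of m is d. *)
Definition quot_depth (m I : R -> Prop) (d : nat) : Prop :=
  (exists s : seq R,
     [/\ forall f, f \in s -> m f, quot_regular I s & size s = d]) /\
  (forall s : seq R,
     (forall f, f \in s -> m f) -> quot_regular I s -> (size s <= d)%N).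

End Ideals.

Definition var_ideal (K : fieldType) (n : nat) (F : {set 'I_n}) :
    {mpoly K[n]} -> Prop :=
  ideal_gen (fun f => exists2 i, i \in F & f = 'X_i).

Definition graded_max_ideal (K : fieldType) (n : nat) : {mpoly K[n]} -> Prop :=
  @var_ideal K n [set: 'I_n].

Definition transversal_ideal (K : fieldType) (n r : nat)
    (F : 'I_r -> {set 'I_n}) : {mpoly K[n]} -> Prop :=
  ideal_prod (fun i => @var_ideal K n (F i)).

Definition intersection_graph (n r : nat) (F : 'I_r -> {set 'I_n}) :
    rel 'I_r :=
  fun i j => (i != j) && (F i :&: F j != set0).

(* n_comp counts connected components because the relation is symmetric. *)
Definition num_components (n r : nat) (F : 'I_r -> {set 'I_n}) : nat :=
  n_comp (intersection_graph F) 'I_r.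

(* Main.v *)
(* Upper bounds on depth come from cohomology: if f is a nonzerodivisor on R/J
   lying in (x_j), multiplication by f is null-homotopic on a Koszul-type
   complex of x, so a regular sequence of length s kills the cohomology in
   degrees < s, while a socle element modulo a regular sequence of length d gives
   a nonzero class in degree d.  Hence a regular sequence in m admitting a socle
   element has length equal to the depth.

   Such a sequence is explicit.  The number c(G_I) + n - |union F_i| counts the
   components of the hypergraph F on the vertex set [n], isolated vertices
   included.  Pick a vertex in each component, u_0, u_1, ..., u_d.  The sequence
   x_(u_0) - x_(u_k) identifies u_k with u_0, and each quotient is again defined
   by a transversal ideal, for the image of F.  Each difference is regular
   because the ideal is the intersection of two monomial ideals, each free of one
   of the two variables.  After all identifications the hypergraph is connected,
   and the edges of a spanning tree of the intersection graph give a monomial of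
   degree r - 1 which all variables multiply into the ideal. *)
Require Import Defs.
From HB Require Import structures.
From mathcomp Require Import all_boot all_order all_algebra.
From mathcomp Require Import mpoly.

Set Implicit Arguments.
Unset Strict Implicit.
Unset Printing Implicit Defensive.

Import GRing.Theory.
Local Open Scope ring_scope.

(** * Ideals as predicates, and adjoining sequences to them *)

Section PropIdeals.

Variable R : comNzRingType.
Implicit Types (J : R -> Prop) (f g h : R) (s : seq R).

Definition is_ideal J : Prop :=
  [/\ J 0, forall f g, J f -> J g -> J (f + g) & forall a f, J f -> J (a * f)].

Lemma is_ideal_opp J f : is_ideal J -> J f -> J (- f).
Proof. by case=> _ _ JM Jf; rewrite -mulN1r; apply: JM. Qed.

Lemma is_ideal_sub J f g : is_ideal J -> J f -> J g -> J (f - g).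
Proof.
by move=> idJ Jf Jg; case: (idJ) => _ JD _; apply: JD => //; apply: is_ideal_opp.
Qed.

Lemma is_ideal_subl J f g : is_ideal J -> J (f - g) -> J g -> J f.
Proof. by case=> _ JD _ Jfg Jg; rewrite -(subrK g f); apply: JD. Qed.

Lemma is_ideal_sum J (I : eqType) (r : seq I) (P : pred I) (E : I -> R) :
  is_ideal J -> (forall i, i \in r -> P i -> J (E i)) ->
  J (\sum_(i <- r | P i) E i).
Proof.
move=> [J0 JD _] JE; rewrite big_seq_cond.
by apply: (big_ind J) => // i /andP[]; apply: JE.
Qed.

Lemma is_ideal_adj J f : is_ideal J -> is_ideal (ideal_adj J f).
Proof.
move=> [J0 JD JM]; split; first by exists 0; rewrite mul0r subr0.
  move=> g h [a Ja] [b Jb]; exists (a + b).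
  by rewrite mulrDl opprD addrACA; apply: JD.
by move=> c g [a Ja]; exists (c * a); rewrite -mulrA -mulrBr; apply: JM.
Qed.

Lemma ideal_adj_sub J f g : J g -> ideal_adj J f g.
Proof. by exists 0; rewrite mul0r subr0. Qed.

Lemma ideal_adj_mem J f : is_ideal J -> ideal_adj J f f.
Proof. by case=> J0 _ _; exists 1; rewrite mul1r subrr. Qed.

Definition ideal_adjs J s : R -> Prop := foldl (@ideal_adj R) J s.

Lemma is_ideal_adjs J s : is_ideal J -> is_ideal (ideal_adjs J s).
Proof.
by elim: s J => //= f s IHs J idJ; apply: IHs; apply: is_ideal_adj.
Qed.

Lemma ideal_adjs_sub J s g : J g -> ideal_adjs J s g.
Proof. by elim: s J => //= f s IHs J Jg; apply/IHs/ideal_adj_sub. Qed.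

Lemma ideal_adjs_mem J s f : is_ideal J -> f \in s -> ideal_adjs J s f.
Proof.
elim: s J => //= g s IHs J idJ; rewrite inE => /predU1P[->|]; last first.
  by apply: IHs; apply: is_ideal_adj.
by apply/ideal_adjs_sub/ideal_adj_mem.
Qed.

Lemma ideal_adjs_rcons J s f :
  ideal_adjs J (rcons s f) = ideal_adj (ideal_adjs J s) f.
Proof. exact: foldl_rcons. Qed.

Lemma ideal_adjs_le J s (J' : R -> Prop) :
  is_ideal J' -> (forall g, J g -> J' g) -> (forall f, f \in s -> J' f) ->
  forall g, ideal_adjs J s g -> J' g.
Proof.
move=> idJ'; elim: s J => [|f s IHs] J JJ' sJ' //=.
apply: IHs => [g [a /JJ' Ja]|g gs]; last by apply: sJ'; rewrite inE gs orbT.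
apply: (is_ideal_subl idJ' Ja); case: idJ' => _ _; apply.
by apply: sJ'; rewrite mem_head.
Qed.

Lemma is_ideal_gen (G : R -> Prop) : is_ideal (ideal_gen G).
Proof.
split; first by exists [::]; rewrite // big_nil.
  move=> f g [s Gs ->] [t Gt ->]; exists (s ++ t); last by rewrite big_cat.
  by move=> p; rewrite mem_cat => /orP[/Gs|/Gt].
move=> a f [s Gs ->]; exists [seq (a * p.1, p.2) | p <- s].
  by move=> p /mapP[q qs ->]; exact: (Gs q qs).
by rewrite big_map mulr_sumr; apply: eq_bigr => p _; rewrite mulrA.
Qed.

Lemma ideal_gen_mem (G : R -> Prop) f : G f -> ideal_gen G f.
Proof.
move=> Gf; exists [:: (1, f)]; last by rewrite big_seq1 mul1r.
by move=> p; rewrite inE => /eqP->.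
Qed.

Lemma ideal_gen_le (G J : R -> Prop) :
  is_ideal J -> (forall f, G f -> J f) -> forall f, ideal_gen G f -> J f.
Proof.
move=> idJ GJ f [s Gs ->]; apply: is_ideal_sum => // p /Gs /GJ Jp _.
by case: idJ => _ _; apply.
Qed.

End PropIdeals.

Lemma is_ideal_preim (R R' : comNzRingType) (phi : {rmorphism R -> R'})
    (J : R' -> Prop) :
  is_ideal J -> is_ideal (fun f => J (phi f)).
Proof.
move=> [J0 JD JM]; split=> [|f g|a f]; rewrite ?rmorph0 ?rmorphD ?rmorphM //.
  exact: JD.
exact: JM.
Qed.

(** * A Koszul-type complex and the length of regular sequences *)

Section CochainComplex.

Variables (R : comNzRingType) (I : finType) (x : I -> R).
Implicit Types (J : R -> Prop) (c b : seq I -> R) (t : seq I).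

(* A degree-i cochain is a function on words of length i.  The recursion unfolds
   to the simplicial sum of (-1)^k x_(t_k) c(t with t_k deleted): a
   non-alternating variant of the Koszul complex of x. *)
Fixpoint cobd c t : R :=
  if t is j :: t' then x j * c t' - cobd (fun u => c (j :: u)) t' else 0.

Definition contr (a : I -> R) c t : R := \sum_j a j * c (j :: t).

Lemma eq_cobd c b t : c =1 b -> cobd c t = cobd b t.
Proof.
elim: t c b => //= j t IHt c b cb.
by rewrite cb; congr (_ - _); apply: IHt => u; apply: cb.
Qed.

Lemma cobd_sum (K : finType) (a : K -> R) (C : K -> seq I -> R) t :
  cobd (fun u => \sum_k a k * C k u) t = \sum_k a k * cobd (C k) t.
Proof.
elim: t C => /= [|j t IHt] C.
  by rewrite big1 // => k _; rewrite mulr0.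
rewrite IHt mulr_sumr -sumrB; apply: eq_bigr => k _.
by rewrite mulrBr mulrCA.
Qed.

Lemma cobdZ a c t : cobd (fun u => a * c u) t = a * cobd c t.
Proof.
elim: t c => /= [|j t IHt] c; first by rewrite mulr0.
by rewrite IHt mulrBr mulrCA.
Qed.

Lemma cobdB c b t : cobd (fun u => c u - b u) t = cobd c t - cobd b t.
Proof.
elim: t c b => /= [|j t IHt] c b; first by rewrite subr0.
by rewrite (IHt (fun u => c _)) mulrBr !opprD !opprK addrACA.
Qed.

Lemma cobd_cobd c t : cobd (cobd c) t = 0.
Proof.
elim: t c => //= j t IHt c.
by rewrite cobdB cobdZ IHt subr0 subrr.
Qed.

(** Cartan-style homotopy formula: contraction with [a] makes multiplication by the sum of the
    [a j * x j] null-homotopic. *)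
Lemma contr_cobd a c t :
  contr a (cobd c) t = (\sum_j a j * x j) * c t - cobd (contr a c) t.
Proof.
rewrite /contr cobd_sum mulr_suml -sumrB.
by apply: eq_bigr => j _ /=; rewrite mulrBr mulrA.
Qed.

Lemma cobd_ideal J c t :
  is_ideal J -> (forall u, (size u).+1 = size t -> J (c u)) -> J (cobd c t).
Proof.
move=> idJ; case: (idJ) => J0 JD JM.
elim: t c => //= j t IHt c Jc; apply: is_ideal_sub => //.
  by apply/JM/Jc.
by apply: IHt => u ut; apply: Jc; rewrite /= ut.
Qed.

(* Vanishing, in degree i, of the cohomology with coefficients in R/J. *)
Definition acyclic J (i : nat) : Prop :=
  forall c, (forall t, size t = i.+1 -> J (cobd c t)) ->
  exists b, forall t, size t = i -> J (c t - cobd b t).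

(** Words of length [i] are finite in number, so no choice axiom is involved; 0 is a default at
    other lengths. *)
Lemma word_choice (i : nat) (P : seq I -> R -> Prop) :
  (forall t, size t = i -> exists e, P t e) ->
  exists e, forall t, size t = i -> P t (e t).
Proof.
move=> exP.
have /fin_all_exists[e eP] : forall t : i.-tuple I, exists e, P t e.
  by move=> t; apply: exP; rewrite size_tuple.
exists (fun t => if insub t is Some u then e u else 0) => t ti.
by case: insubP => [u _ <-|]; [apply: eP | rewrite ti eqxx].
Qed.

(** Modulo [J], [f * c] is the coboundary of [contr a c], which is thus a cocycle modulo [J] and
    [f], hence of the form [cobd b + f * e]. So [f * c] agrees with [f * cobd e], and [f]
    cancels. *)
Lemma acyclic_nzd J f i :
  is_ideal J -> (exists a, f = \sum_j a j * x j) -> quot_nzd J f ->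
  (forall k, k < i -> acyclic (ideal_adj J f) k)%N -> acyclic J i.
Proof.
move=> idJ [a fE] nzdf acJf c cocyc.
case: (idJ) => J0 JD JM.
have homot t : size t = i -> J (f * c t - cobd (contr a c) t).
  move=> ti; rewrite fE -contr_cobd; apply: is_ideal_sum => // j _ _.
  by apply/JM/cocyc; rewrite /= ti.
case: i => [|i] in acJf cocyc homot *.
  exists (fun=> 0) => -[] // _; rewrite /= subr0; apply: nzdf.
  by have := homot [::] erefl; rewrite /= subr0.
have [|b bP] := acJf i (ltnSn i) (contr a c).
  move=> t ti; exists (c t); rewrite -opprB mulrC.
  by apply: is_ideal_opp => //; apply: homot.
have [e eP] := word_choice bP.
exists e => t ti; apply: nzdf; rewrite mulrBr -cobdZ.
apply: (is_ideal_subl (g := cobd (fun u => contr a c u - f * e u) t)) => //.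
  by rewrite cobdB opprB addrA subrK; apply: homot.
(* Subtracting the cocycle [cobd b] leaves the coboundary unchanged and brings the cochain into
   [J]. *)
have -> : cobd (fun u => contr a c u - f * e u) t =
          cobd (fun u => contr a c u - cobd b u - e u * f) t.
  rewrite [RHS](eq_cobd (b := fun u => contr a c u - f * e u - cobd b u)).
    by rewrite [RHS]cobdB cobd_cobd subr0.
  by move=> u; rewrite addrAC mulrC.
by apply: cobd_ideal => // u; rewrite ti => -[ui]; apply: eP.
Qed.

Lemma acyclic_regular J s i :
  is_ideal J -> (forall f, f \in s -> exists a, f = \sum_j a j * x j) ->
  quot_regular J s -> (i < size s)%N -> acyclic J i.
Proof.
elim: s J i => //= f s IHs J i idJ sx [nzdf regs]; rewrite ltnS => is_.
apply: (acyclic_nzd idJ _ nzdf); first by apply: sx; rewrite mem_head.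
move=> k ki; apply: IHs => //; first exact: is_ideal_adj.
  by move=> g gs; apply: sx; rewrite inE gs orbT.
exact: leq_trans ki is_.
Qed.

(** This is the long exact sequence of multiplication by [f]: if [cobd c] is [e * f] modulo [J],
    then [e] is a cocycle, [e] is some [cobd b], and [c - f * b] is a cocycle modulo [J]. *)
Lemma acyclic_adj J f i :
  is_ideal J -> quot_nzd J f -> acyclic J i -> acyclic J i.+1 ->
  acyclic (ideal_adj J f) i.
Proof.
move=> idJ nzdf acJ acJS c cocyc; case: (idJ) => J0 JD JM.
have [e eP] := word_choice cocyc.
have [b bP] : exists b, forall t, size t = i.+1 -> J (e t - cobd b t).
  apply: acJS => t ti; apply: nzdf.
  have := cobd_ideal (t := t) idJ (c := fun u => cobd c u - e u * f).
  rewrite cobdB cobd_cobd sub0r ti => /(_ _) Je.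
  rewrite -cobdZ -[cobd _ t]opprK; apply: is_ideal_opp => //.
  have <- : cobd (fun u => e u * f) t = cobd (fun u => f * e u) t.
    by apply: eq_cobd => u; rewrite mulrC.
  by apply: Je => u [ui]; apply: eP.
have [b' b'P] : exists b', forall t, size t = i ->
    J ((c t - f * b t) - cobd b' t).
  apply: acJ => t ti; rewrite cobdB cobdZ.
  rewrite (_ : _ - _ = (cobd c t - e t * f) + f * (e t - cobd b t)).
    by apply: JD; [apply: eP | apply/JM/bP].
  by rewrite mulrBr addrA [e t * f]mulrC subrK.
exists b' => t ti; exists (b t).
by rewrite addrAC mulrC; apply: b'P.
Qed.

(* A socle element modulo J and s is a nonzero degree-0 class modulo (J, s);
   the connecting maps carry it up to degree [size s] modulo J. *)
Lemma acyclic_socle J s :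
  is_ideal J -> (forall f, f \in s -> exists a, f = \sum_j a j * x j) ->
  quot_regular J s ->
  (exists2 g, ~ ideal_adjs J s g & forall j, ideal_adjs J s (x j * g)) ->
  ~ acyclic J (size s).
Proof.
elim: s J => [|f s IHs] J idJ sx regs [g nJg xJg] acJ; rewrite /= in acJ.
  (* Coboundaries vanish on the empty word, so acyclicity in degree 0 would put [g] in [J]. *)
  have [|b /(_ [::] erefl)] := acJ (fun=> g); last by rewrite /= subr0.
  by case=> [|j []] //= _; rewrite subr0; apply: xJg.
have sx' h : h \in s -> exists a, h = \sum_j a j * x j.
  by move=> hs; apply: sx; rewrite inE hs orbT.
have [nzdf regs'] := regs.
apply: (IHs _ (is_ideal_adj f idJ) sx' regs'); first by exists g.
by apply: acyclic_adj => //; apply: (acyclic_regular idJ sx regs).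
Qed.

Lemma maximal_regular_depth J s :
  is_ideal J ->
  (forall f, f \in s -> exists a, f = \sum_j a j * x j) ->
  quot_regular J s ->
  (exists2 g, ~ ideal_adjs J s g & forall j, ideal_adjs J s (x j * g)) ->
  forall s', (forall f, f \in s' -> exists a, f = \sum_j a j * x j) ->
  quot_regular J s' -> (size s' <= size s)%N.
Proof.
move=> idJ sx regs soc s' sx' regs'; rewrite leqNgt; apply/negP => lt_s.
exact: acyclic_socle idJ sx regs soc (acyclic_regular idJ sx' regs' lt_s).
Qed.

End CochainComplex.

Lemma big_setT (R : Type) (idx : R) (op : R -> R -> R) (I : finType) (E : I -> R) :
  \big[op/idx]_(i in [set: I]) E i = \big[op/idx]_i E i.
Proof. by apply: eq_bigl => i; rewrite in_setT. Qed.

(** * Monomial ideals and differences of variables *)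

Section MonomialIdeals.

Variables (K : fieldType) (n : nat).
Implicit Types (Q : 'X_{1..n} -> Prop) (f g : {mpoly K[n]}) (m : 'X_{1..n}).

Definition supported Q f : Prop := forall m, m \in msupp f -> Q m.

Lemma is_ideal_supported Q :
  (forall m m', Q m -> Q (m + m')%MM) -> is_ideal (supported Q).
Proof.
move=> Qup; split=> [m|f g Qf Qg m /msuppD_le|a f Qf m /msuppM_le].
- by rewrite msupp0.
- by rewrite mem_cat => /orP[/Qf|/Qg].
by case/allpairsP=> -[m1 m2] /= [_ /Qf Qm2 ->]; rewrite addmC; apply: Qup.
Qed.

(* Modulo the ideal, multiplication by x_v permutes the monomials outside it, so
   ('X_u - 'X_v) * g = 0 forces g@_m = g@_(m + v - u); iterating exhausts the
   exponent of x_u. *)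
Lemma supported_subXX_nzd Q (u v : 'I_n) g :
  u != v -> (forall m m', Q m -> Q (m + m')%MM) ->
  (forall m, Q (U_(v) + m)%MM -> Q m) ->
  supported Q (('X_u - 'X_v) * g) -> supported Q g.
Proof.
move=> uv Qup Qv Qg m.
have [k] := ubnP (m u); elim: k m => // k IHk m; rewrite ltnS => mu gm.
have coefE : (('X_u - 'X_v) * g)@_(U_(v) + m) =
             (g * 'X_u)@_(U_(v) + m) - g@_m.
  by rewrite mulrBl mcoeffB -!(mulrC g) mcoeffMX.
have [ceq0|cneq0] := eqVneq ((('X_u - 'X_v) * g)@_(U_(v) + m)) 0; last first.
  by apply/Qv/Qg; rewrite mcoeff_msupp.
have : (U_(v) + m)%MM \in msupp (g * 'X_u).
  rewrite mcoeff_msupp; move: coefE; rewrite ceq0 => /esym/eqP.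
  by rewrite subr_eq0 => /eqP->; rewrite -mcoeff_msupp.
rewrite (perm_mem (msuppMX _ _)) => /mapP[m' gm' mE].
apply: Qv; rewrite mE addmC; apply/Qup/IHk => //.
move/mnmP/(_ u): mE; rewrite !mnmDE !mnm1E eqxx eq_sym (negPf uv) add0n.
by move=> mE; rewrite mE in mu.
Qed.

End MonomialIdeals.

(** * Transversal ideals as monomial ideals *)

Section Transversal.

Variables (K : fieldType) (n r : nat).
Implicit Types (F : 'I_r -> {set 'I_n}) (T : {set 'I_r}) (m : 'X_{1..n}).
Implicit Types (J : {mpoly K[n]} -> Prop) (a : 'I_r -> 'I_n).

Lemma var_idealP (A : {set 'I_n}) (f : {mpoly K[n]}) :
  var_ideal A f -> exists c, f = \sum_(j in A) c j * 'X_j.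
Proof.
apply: (ideal_gen_le (J := fun f => exists c, f = \sum_(j in A) c j * 'X_j)).
  split; first by exists (fun=> 0); rewrite big1 // => j _; rewrite mul0r.
    move=> _ _ [c ->] [d ->]; exists (fun j => c j + d j).
    by rewrite -big_split; apply: eq_bigr => j _; rewrite mulrDl.
  move=> b _ [c ->]; exists (fun j => b * c j).
  by rewrite mulr_sumr; apply: eq_bigr => j _; rewrite mulrA.
move=> _ [i iA ->]; exists (fun j => (j == i)%:R).
rewrite (bigD1 i) //= eqxx mul1r big1 ?addr0 // => j /andP[_ /negPf->].
by rewrite mul0r.
Qed.

Lemma var_ideal_mem (A : {set 'I_n}) i :
  i \in A -> @var_ideal K n A 'X_i.
Proof. by move=> iA; apply: ideal_gen_mem; exists i. Qed.

Lemma transversal_mem F a :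
  (forall i, a i \in F i) -> transversal_ideal F (\prod_i 'X_(a i) : {mpoly K[n]}).
Proof.
move=> aF; apply: ideal_gen_mem; exists (fun i => 'X_(a i)) => // i.
exact: var_ideal_mem.
Qed.

Lemma transversal_le F J :
  is_ideal J -> (forall a, (forall i, a i \in F i) -> J (\prod_i 'X_(a i))) ->
  forall f, transversal_ideal F f -> J f.
Proof.
move=> idJ JX; apply: ideal_gen_le => // f [b bF ->].
have /fin_all_exists[c cE] : forall i, exists c, b i = \sum_(j in F i) c j * 'X_j.
  by move=> i; apply/var_idealP/bF.
rewrite (eq_bigr _ (fun i _ => cE i)) bigA_distr_big_dep.
apply: is_ideal_sum => // a _ /familyP aF; rewrite big_split /=.
by case: idJ => _ _; apply; apply: JX.
Qed.

Lemma is_ideal_transversal F : is_ideal (@transversal_ideal K n r F).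
Proof. exact: is_ideal_gen. Qed.

(* The monomial X^m is divisible by a product of variables x_(a i) in F i, i in T. *)
Definition covers F T m : Prop :=
  exists2 a, (forall i, i \in T -> a i \in F i) &
             (\sum_(i in T) U_(a i) <= m)%MM.

Lemma coversD F T m m' : covers F T m -> covers F T (m + m').
Proof. by case=> a aF am; exists a => //; apply: lepm_trans am (lem_addr _ _). Qed.

Lemma mnm_sum1E T a j : (\sum_(i in T) U_(a i))%MM j = (\sum_(i in T) (a i == j))%N.
Proof. by rewrite mnm_sumE; apply: eq_bigr => i _; rewrite mnm1E. Qed.

Lemma mnm_sum1_eq0 F T a j :
  (forall i, i \in T -> a i \in F i) -> (forall i, i \in T -> j \notin F i) ->
  (\sum_(i in T) U_(a i))%MM j = 0%N.
Proof.
move=> aF jF; rewrite mnm_sum1E big1 // => i iT.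
by case: eqP => // aij; case/negP: (jF i iT); rewrite -aij aF.
Qed.

Lemma covers_insensitive F T v m :
  (forall i, i \in T -> v \notin F i) -> covers F T (U_(v) + m) -> covers F T m.
Proof.
move=> vF [a aF /mnm_lepP am]; exists a => //; apply/mnm_lepP => j.
have := am j; rewrite mnmDE mnm1E; case: eqP => // <- _.
by rewrite (mnm_sum1_eq0 aF).
Qed.

(** The two dividing monomials involve disjoint sets of variables, inside and outside [B], so their
    product divides too. *)
Lemma covers_split F (B : {set 'I_n}) T m :
  (forall i, i \in T -> F i \subset B) ->
  (forall i, i \notin T -> [disjoint F i & B]) ->
  covers F T m -> covers F (~: T) m -> covers F setT m.
Proof.
move=> FB FB' [a aF /mnm_lepP am] [b bF /mnm_lepP bm].
exists (fun i => if i \in T then a i else b i) => [i _|].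
  by case: ifPn => iT; [apply: aF | apply: bF; rewrite inE].
apply/mnm_lepP => j; rewrite mnm_sum1E big_setT (bigID (mem T)) /=.
rewrite (eq_bigr (fun i => (a i == j) : nat)) => [|i ->//].
rewrite [X in (_ + X)%N](eq_big (mem (~: T)) (fun i => (b i == j) : nat)); last 2 first.
- by move=> i; rewrite !inE.
- by move=> i /negPf->.
rewrite -!mnm_sum1E; have [jB|jB] := boolP (j \in B).
  rewrite [X in (_ + X)%N](mnm_sum1_eq0 bF) ?addn0 // => i; rewrite inE => /FB'.
  by rewrite disjoint_sym => /disjointFr->.
rewrite (mnm_sum1_eq0 aF) ?add0n // => i /FB /subsetP FiB.
by apply: contra jB; apply: FiB.
Qed.

Lemma transversal_supported F (f : {mpoly K[n]}) :
  transversal_ideal F f <-> supported (covers F setT) f.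
Proof.
split.
  apply: transversal_le => [|a aF m].
    by apply: is_ideal_supported => m m'; apply: coversD.
  rewrite mprodXE => /mem_msuppXP <-; exists a => //.
  by rewrite big_setT lepm_refl.
move=> Qf; rewrite [f]mpolyE; have idI := is_ideal_transversal F.
apply: is_ideal_sum => // m /Qf[a aF am] _.
case: idI => _ _ IM; rewrite -mul_mpolyC; apply: (IM).
rewrite -(submK am) mpolyXD; apply: IM.
rewrite big_setT -mprodXE; apply: transversal_mem => i.
exact/aF/in_setT.
Qed.

(** The ideal is the intersection of a part from the [F i] inside [B], free of ['X_u], and a part
    from those disjoint from [B], free of ['X_v]. *)
Lemma transversal_subXX_nzd F (B : {set 'I_n}) u v :
  u \notin B -> v \in B ->
  (forall i, F i \subset B \/ [disjoint F i & B]) ->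
  @quot_nzd {mpoly K[n]} (transversal_ideal F) ('X_u - 'X_v).
Proof.
move=> uB vB FB g; rewrite !transversal_supported => Qg.
pose T := [set i | F i \subset B].
have TP i : i \in T -> F i \subset B by rewrite inE.
have TP' i : i \notin T -> [disjoint F i & B].
  by rewrite inE; case: (FB i) => // ->.
have uv : u != v by apply: contraNneq uB => ->.
have sub T' m : covers F setT m -> covers F T' m.
  case=> a aF /mnm_lepP am; exists a => [i _|]; first exact/aF/in_setT.
  apply/mnm_lepP => j; apply: leq_trans (am j).
  rewrite !mnm_sum1E big_setT [leqRHS](bigID (mem T')) /=; exact: leq_addr.
have QT : supported (covers F (~: T)) g.
  apply: (supported_subXX_nzd uv) => [m m'|m|m mg].
  - exact: coversD.
  - apply: covers_insensitive => i; rewrite inE => /TP'.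
    by rewrite disjoint_sym => /disjointFr->.
  exact/sub/Qg.
have QT' : supported (covers F T) g.
  apply: (supported_subXX_nzd (u := v) (v := u)) => [|m m'|m|m mg].
  - by rewrite eq_sym.
  - exact: coversD.
  - by apply: covers_insensitive => i /TP /subsetP FiB; apply: contra uB; apply: FiB.
  by apply/sub/Qg; rewrite -opprB mulNr (perm_mem (msuppN _)) in mg.
by move=> m mg; apply: (covers_split TP TP'); [apply: QT' | apply: QT].
Qed.

Lemma transversal_mdeg F (f : {mpoly K[n]}) m :
  transversal_ideal F f -> m \in msupp f -> (r <= mdeg m)%N.
Proof.
move=> /transversal_supported Qf /Qf[a _ /submK <-].
rewrite mdegD mdeg_sum (eq_bigr (fun=> 1%N)) => [|i _]; last exact: mdeg1.
by rewrite sum1_card cardsT card_ord leq_addl.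
Qed.

(* A spanning tree of the intersection graph of F supplies r - 1 vertices w; for
   j in F l, the path from l to the root shifts the vertices of its edges by one
   step, which leaves F l free to receive j. *)
Lemma socle_monomial F (i0 : 'I_r) :
  (forall T, i0 \in T ->
     (forall i k, i \in T -> F i :&: F k != set0 -> k \in T) -> T = setT) ->
  exists2 m : 'X_{1..n},
    [/\ (mdeg m < r)%N & forall j, m j != 0%N -> exists i, j \in F i]
    & forall i j, j \in F i -> covers F setT (m + U_(j)).
Proof.
move=> conn.
(* Invariant of a tree grown one index at a time: [T] holds the indices reached, [m] one common
   vertex per edge. *)
pose P T m := [/\ mdeg m < #|T|, forall j, m j != 0 -> exists i, j \in F i
  & forall i j, i \in T -> j \in F i -> covers F T (m + U_(j))]%N.
suff [m [mT mF mc]] : exists m, P setT m.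
  by exists m; [rewrite cardsT card_ord in mT | move=> i j; apply: mc].
suff grow k T : i0 \in T -> (#|~: T| < k)%N -> (exists m, P T m) ->
    exists m, P setT m.
  apply: (grow _ [set i0] (set11 _) (leqnn _)); exists 0%MM; split.
  - by rewrite mdeg0 cards1.
  - by move=> j; rewrite mnm0E.
  move=> i j /set1P-> jF; exists (fun=> j) => [k /set1P->//|].
  by rewrite big_set1 add0m lepm_refl.
elim: k T => // k IHk T i0T; rewrite ltnS => Tk [m [mT mF mc]].
have [/eqP TT|TT] := boolP (T == setT); first by exists m; rewrite -TT.
have [/exists_inP[i iT /existsP[l /andP[Fil lT]]]|noedge] :=
  boolP [exists i in T, exists l, (F i :&: F l != set0) && (l \notin T)];
  last first.
  case/eqP: TT; apply: conn => // i l iT Fil; apply: contraNT noedge => lT.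
  by apply/exists_inP; exists i => //; apply/existsP; exists l; rewrite Fil.
have /set0Pn[w /setIP[wi wl]] := Fil.
apply: (IHk (l |: T)); first by rewrite inE i0T orbT.
  apply: leq_trans Tk; apply: proper_card; rewrite setCU properE subsetIr /=.
  by apply/subsetPn; exists l; rewrite !inE ?eqxx // .
have coversU a b m' : b \in F l -> (forall i, i \in T -> a i \in F i) ->
    (\sum_(i in T) U_(a i) <= m')%MM -> covers F (l |: T) (m' + U_(b)).
  move=> bl aF am; exists (fun k => if k == l then b else a k).
    move=> k'; rewrite 2!inE; case: eqP => [->//|_ /=]; exact: aF.
  rewrite big_setU1 //= eqxx addmC; apply/mnm_lepP => j; rewrite !mnmDE leq_add2r.
  move/mnm_lepP/(_ j): am; apply: leq_trans; rewrite !mnm_sum1E.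
  apply: leq_sum => k' kT; case: (k' =P l) => // kl; by rewrite -kl kT in lT.
(* For [j] in [F l], [w] acts as a vertex of [F i] and [j] serves [l]; for [j] in an older [F i'],
   [w] serves [l]. *)
exists (m + U_(w))%MM; split.
- by rewrite mdegD mdeg1 addn1 cardsU1 lT.
- move=> j; rewrite mnmDE mnm1E; case: (w =P j) => [<- _|_]; first by exists l.
  by rewrite addn0; apply: mF.
move=> i' j; rewrite 2!inE => /predU1P[->|iT'] jF.
  by have [a aF am] := mc _ _ iT wi; apply: coversU am.
have [a aF am] := mc _ _ iT' jF.
by rewrite -addmA [(U_(w) + _)%MM]addmC addmA; apply: coversU am.
Qed.

End Transversal.

(** * Identification of variables *)

Section Substitution.

Variables (K : fieldType) (n : nat) (pi : 'I_n -> 'I_n).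

Definition var_subst (f : {mpoly K[n]}) : {mpoly K[n]} :=
  f \mPo [tuple 'X_(pi i) | i < n].

HB.instance Definition _ := GRing.RMorphism.copy var_subst
  (comp_mpoly [tuple ('X_(pi i) : {mpoly K[n]}) | i < n]).

Lemma var_substX i : var_subst 'X_i = 'X_(pi i).
Proof. by rewrite /var_subst comp_mpolyXU -tnth_nth tnth_mktuple. Qed.

Lemma var_substXm (m : 'X_{1..n}) : var_subst 'X_[m] = \prod_i 'X_(pi i) ^+ m i.
Proof.
rewrite /var_subst comp_mpolyX; apply: eq_bigr => i _.
by rewrite tnth_mktuple.
Qed.

Lemma var_subst_congr (J : {mpoly K[n]} -> Prop) f :
  is_ideal J -> (forall i, J ('X_i - 'X_(pi i))) -> J (f - var_subst f).
Proof.
move=> idJ JX; case: (idJ) => J0 JD JM.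
have JXm m : J ('X_[m] - var_subst 'X_[m]).
  rewrite var_substXm mpolyXE_id.
  apply: (big_rec2 (fun p q => J (p - q))) => [|i p q _ Jpq].
    by rewrite subrr.
  suff Jpow k : J ('X_i ^+ k - 'X_(pi i) ^+ k).
    rewrite (_ : _ - _ = 'X_i ^+ m i * (p - q) +
                         q * ('X_i ^+ m i - 'X_(pi i) ^+ m i)); last first.
      by rewrite !mulrBr !(mulrC q) addrA subrK.
    by apply: JD; apply: JM.
  by rewrite subrXX mulrC; apply: JM.
elim/mpolyind: f => [|c m p _ _ Jp]; first by rewrite rmorph0 subrr.
rewrite rmorphD opprD addrACA; apply: JD => //.
have -> : c *: 'X_[m] - var_subst (c *: 'X_[m]) =
          c%:MP * ('X_[m] - var_subst 'X_[m]).
  by rewrite -mul_mpolyC rmorphM mulrBr /=; congr (_ - _ * _); apply: comp_mpolyC.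
exact: JM.
Qed.

(** The substitution kills [s] and sends generators to generators; conversely [g] is congruent to
    its image, and generators of the image ideal lift. *)
Lemma ideal_adjs_transversal (r : nat) (F : 'I_r -> {set 'I_n}) s g :
  (forall i, ideal_adjs (@transversal_ideal K n r F) s ('X_i - 'X_(pi i))) ->
  (forall f, f \in s -> var_subst f = 0) ->
  ideal_adjs (@transversal_ideal K n r F) s g <->
  @transversal_ideal K n r (fun i => pi @: F i) (var_subst g).
Proof.
set J := ideal_adjs _ s => JX s0.
have idI := @is_ideal_transversal K n r F.
have idJ : is_ideal J by apply: is_ideal_adjs.
have idI' := @is_ideal_transversal K n r (fun i => pi @: F i).
have substP (a : 'I_r -> 'I_n) :
    var_subst (\prod_i 'X_(a i)) = \prod_i 'X_(pi (a i)).
  by rewrite rmorph_prod; apply: eq_bigr => i _; apply: var_substX.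
split.
  apply: (ideal_adjs_le (is_ideal_preim var_subst idI')) => [f|f /s0 /= ->].
    apply: (transversal_le (is_ideal_preim var_subst idI')) => a aF.
    by rewrite /= substP; apply: transversal_mem => i; apply: imset_f.
  by case: idI'.
move=> I'g; apply: (is_ideal_subl idJ (var_subst_congr g idJ JX)).
apply: transversal_le I'g => // b bF.
have /fin_all_exists2[a aF bE] : forall i, exists2 j, j \in F i & b i = pi j.
  by move=> i; apply/imsetP.
have -> : \prod_i 'X_(b i) = var_subst (\prod_i 'X_(a i)).
  by rewrite substP; apply: eq_bigr => i _; rewrite bE.
rewrite -(subKr (\prod_i 'X_(a i)) (var_subst _)); apply: is_ideal_sub => //.
  by apply/ideal_adjs_sub/transversal_mem.
exact: var_subst_congr.
Qed.

End Substitution.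

(** * The explicit regular sequence and its socle element *)

Section MergedVariables.

Variables (K : fieldType) (n r : nat) (F : 'I_r -> {set 'I_n}) (u0 : 'I_n).
Implicit Types (ts vs : seq 'I_n).

Let I := @transversal_ideal K n r F.

Definition collapse ts (i : 'I_n) : 'I_n := if i \in ts then u0 else i.

Definition var_diffs ts : seq {mpoly K[n]} := [seq 'X_u0 - 'X_v | v <- ts].

Lemma collapse_base ts : u0 \notin ts -> collapse ts u0 = u0.
Proof. by rewrite /collapse => /negPf->. Qed.

Lemma collapseK ts i : u0 \notin ts -> collapse ts (collapse ts i) = collapse ts i.
Proof.
rewrite /collapse => /negPf u0ts.
by have [its|/negPf its] := boolP (i \in ts); rewrite ?u0ts ?its.
Qed.

Lemma adjs_var_diffs ts g : u0 \notin ts ->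
  ideal_adjs I (var_diffs ts) g <->
  transversal_ideal (fun i => collapse ts @: F i) (var_subst (collapse ts) g).
Proof.
move=> u0ts; have idI := @is_ideal_transversal K n r F.
have idJ := is_ideal_adjs (var_diffs ts) idI.
apply: ideal_adjs_transversal => [i|_ /mapP[v vts ->]].
  rewrite /collapse; case: ifP => its; last first.
    by rewrite subrr; case: idJ.
  rewrite -opprB; apply: is_ideal_opp => //; apply: ideal_adjs_mem => //.
  exact: map_f.
by rewrite rmorphB /= !var_substX collapse_base // /collapse vts subrr.
Qed.

(** No [F i] crosses the boundary of [B], so [B] is a union of hypergraph components; this avoids
    speaking of paths. *)
Definition separated us : Prop := forall v, v \in us ->
  exists B : {set 'I_n}, [/\ v \in B, forall w, w \in u0 :: us -> w \in B -> w = v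
    & forall i, F i \subset B \/ [disjoint F i & B]].

Lemma var_diffs_regular ts vs :
  uniq (u0 :: ts ++ vs) -> separated (ts ++ vs) ->
  ~ ideal_adjs I (var_diffs (ts ++ vs)) 1 ->
  quot_regular (ideal_adjs I (var_diffs ts)) (var_diffs vs).
Proof.
elim: vs ts => [|v vs IHvs] ts; first by rewrite cats0.
move=> uniqL sepL n1; split; last first.
  rewrite -ideal_adjs_rcons -map_rcons.
  by apply: IHvs; rewrite cat_rcons.
have u0ts : u0 \notin ts.
  by move: uniqL; rewrite /= mem_cat negb_or => /andP[/andP[]].
have vts : v \notin ts.
  move: uniqL => /= /andP[_]; rewrite cat_uniq => /and3P[_ + _].
  by rewrite /= negb_or => /andP[].
have vL : v \in ts ++ v :: vs by rewrite mem_cat mem_head orbT.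
have [B [vB BL FB]] := sepL v vL.
have wB w : w \in u0 :: ts -> w \notin B.
  move=> wts; apply/negP => wB; have wv : w = v.
    apply: BL wB; move: wts; rewrite !inE mem_cat.
    by case/orP=> ->; rewrite ?orbT.
  move: wts; rewrite wv inE (negPf vts) orbF => /eqP vu0.
  by move: uniqL; rewrite -vu0 /= vL.
move=> g; rewrite !adjs_var_diffs // rmorphM rmorphB /= !var_substX.
rewrite collapse_base // (_ : collapse ts v = v); last first.
  by rewrite /collapse (negPf vts).
apply: (transversal_subXX_nzd (B := B)) => //; first by apply: wB; rewrite mem_head.
(* Only vertices outside [B] are merged, so [B] still separates the collapsed family. *)
have collapseB j : (collapse ts j \in B) = (j \in B).
  rewrite /collapse; case: ifP => // jts.
  by rewrite !(negPf (wB _ _)) // inE ?eqxx ?jts ?orbT.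
move=> i; case: (FB i) => [/subsetP FiB|dis]; [left | right].
  by apply/subsetP => _ /imsetP[j jF ->]; rewrite collapseB FiB.
rewrite disjoint_subset; apply/subsetP => _ /imsetP[j jF ->].
by rewrite !inE collapseB (disjointFr dis).
Qed.

Lemma var_diffs_socle us i0 :
  u0 \notin us ->
  (forall T : {set 'I_r}, i0 \in T ->
     (forall i k, i \in T ->
        (collapse us @: F i) :&: (collapse us @: F k) != set0 -> k \in T) ->
     T = setT) ->
  (forall j, exists i, collapse us j \in collapse us @: F i) ->
  exists2 g, ~ ideal_adjs I (var_diffs us) g &
    forall j, ideal_adjs I (var_diffs us) ('X_j * g).
Proof.
move=> u0us conn cover; have [m [mr mF mc]] := socle_monomial conn.
(* The variables of [m] lie in the image of the idempotent [collapse us], hence are fixed. *)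
have substm : var_subst (collapse us) 'X_[K, m] = 'X_[m].
  rewrite var_substXm mpolyXE_id; apply: eq_bigr => j _.
  have [->|mj] := eqVneq (m j) 0%N; first by rewrite !expr0.
  by have [i /imsetP[j' _ ->]] := mF j mj; rewrite collapseK.
exists 'X_[m] => [|j]; rewrite adjs_var_diffs // ?rmorphM /= substm.
  move=> Im; have := transversal_mdeg (m := m) Im.
  by rewrite msuppX mem_head leqNgt mr => /(_ isT).
rewrite var_substX -mpolyXD; apply/transversal_supported => _ /mem_msuppXP<-.
by rewrite addmC; have [i] := cover j; apply: mc.
Qed.

End MergedVariables.

(** * Representatives of the hypergraph components *)

Section ComponentRepresentatives.

Variables (n r : nat) (F : 'I_r -> {set 'I_n}) (u : 'I_r -> 'I_n).
Hypothesis uF : forall i, u i \in F i.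

Let e := intersection_graph F.

Lemma intersection_graph_connect_sym : connect_sym e.
Proof.
by apply: sym_connect_sym => i j; rewrite /e /intersection_graph eq_sym setIC.
Qed.

Lemma root_intersection_graph i j x :
  x \in F i -> x \in F j -> fingraph.root e i = fingraph.root e j.
Proof.
move=> xi xj; apply/(fingraph.rootP intersection_graph_connect_sym).
have [->|ij] := eqVneq i j; first exact: connect0.
apply: connect1; rewrite /e /intersection_graph ij.
by apply/set0Pn; exists x; rewrite inE xi.
Qed.

(* One vertex for each connected component of the hypergraph F on all of [n],
   vertices outside every F i being components of their own. *)
Definition component_reps : seq 'I_n :=
  [seq u i | i <- enum (roots e)] ++ enum (~: \bigcup_(i < r) F i).

Lemma notin_bigcup x i : x \notin \bigcup_(i < r) F i -> x \notin F i.
Proof. by apply: contra => xF; apply/bigcupP; exists i. Qed.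

Lemma component_reps_uniq : uniq component_reps.
Proof.
rewrite cat_uniq map_inj_in_uniq ?enum_uniq ?andbT => [|i j]; last first.
  rewrite !mem_enum => /eqP ri /eqP rj uij.
  by rewrite -ri -rj; apply: (@root_intersection_graph _ _ (u i)) => //; rewrite uij.
apply/hasPn => x; rewrite mem_enum inE; apply: contra => /mapP[i _ ->].
by apply/bigcupP; exists i.
Qed.

Lemma size_component_reps :
  size component_reps = (num_components F + (n - #|\bigcup_(i < r) F i|))%N.
Proof.
rewrite size_cat size_map -!cardE [#|~: _|]cardsCs setCK card_ord; congr (_ + _)%N.
by apply: eq_card => i; rewrite !inE andbT.
Qed.

(** The set [B] is the singleton of an isolated vertex, or the union of the [F k] in one graph
    component. *)
Lemma component_reps_separated v : v \in component_reps ->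
  exists B : {set 'I_n}, [/\ v \in B,
    forall w, w \in component_reps -> w \in B -> w = v
    & forall i, F i \subset B \/ [disjoint F i & B]].
Proof.
rewrite mem_cat => /orP[/mapP[i]|]; rewrite mem_enum; last first.
  rewrite inE => vU; exists [set v]; split; first exact: set11.
    by move=> w _ /set1P.
  by move=> i; right; rewrite disjoint_sym disjoints1 notin_bigcup.
move=> /eqP ri ->; exists (\bigcup_(k | fingraph.root e k == i) F k); split.
- by apply/bigcupP; exists i => //; apply/eqP.
- move=> w + /bigcupP[k /eqP rk wk].
  rewrite mem_cat => /orP[/mapP[j]|]; rewrite mem_enum.
    move=> /eqP rj wE; rewrite wE; congr u.
    by rewrite -rj -rk; apply: (@root_intersection_graph _ _ w) => //; rewrite wE.
  by rewrite inE => /notin_bigcup => /(_ k); rewrite wk.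
move=> l; have [rl|rl] := eqVneq (fingraph.root e l) i; [left | right].
  by apply: (bigcup_sup l); rewrite ?rl.
rewrite disjoint_subset; apply/subsetP => x xl; rewrite !inE.
apply: contra rl => /bigcupP[k /eqP <- xk].
by apply/eqP; apply: root_intersection_graph xl xk.
Qed.

End ComponentRepresentatives.

(* Natural subtraction is exact here: there is at least one component since
   0 < r, and the union has at most n elements. *)
Theorem theorem3p12 (K : fieldType) (n r : nat) (F : 'I_r -> {set 'I_n})
    (hr : (0 < r)%N) (hF : forall i : 'I_r, F i != set0) :
  quot_depth (@graded_max_ideal K n) (@transversal_ideal K n r F)
    (num_components F - 1 + n - #|\bigcup_(i < r) F i|)%N.
Proof.
have /fin_all_exists[u uF] : forall i, exists x, x \in F i.
  by move=> i; apply/set0Pn/hF.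
have linear f : graded_max_ideal f -> exists a, f = \sum_j a j * 'X_j :> {mpoly K[n]}.
  by move=> /var_idealP[a ->]; exists a; rewrite big_setT.
set e := intersection_graph F.
have csym : connect_sym e := intersection_graph_connect_sym F.
have := component_reps_separated uF; have := component_reps_uniq uF.
have := size_component_reps F u.
have : forall i, u (fingraph.root e i) \in component_reps F u.
  by move=> i; rewrite mem_cat map_f // mem_enum; apply: roots_root.
have : forall j, j \notin \bigcup_(i < r) F i -> j \in component_reps F u.
  by move=> j jU; rewrite mem_cat mem_enum in_setC jU orbT.
(* As [r] is positive, the list starts with a vertex of some [F i0], the base of all
   identifications. *)
have : exists2 i0, u i0 = head (u (Ordinal hr)) (component_reps F u) &
    component_reps F u != [::].
  have : fingraph.root e (Ordinal hr) \in enum (roots e).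
    by rewrite mem_enum; apply: roots_root.
  by rewrite /component_reps -/e; case: (enum (roots e)) => // i0 s _; exists i0.
case: (component_reps F u) => [[]//|u0 us] [i0 /= ui0 _] outU rootL sizeL uniqL sepL.
have /andP[u0us _] := uniqL.
pose pi := collapse u0 us.
have piL j : j \in u0 :: us -> pi j = u0.
  by rewrite inE /pi => /predU1P[->|jus]; rewrite ?collapse_base // /collapse jus.
have u0i0 : u0 \in pi @: F i0.
  by rewrite -[X in X \in _](piL u0 (mem_head _ _)) -ui0 imset_f.
have soc : exists2 g,
    ~ ideal_adjs (@transversal_ideal K n r F) (var_diffs K u0 us) g &
    forall j, ideal_adjs (transversal_ideal F) (var_diffs K u0 us) ('X_j * g).
  have := @var_diffs_socle K n r F u0 us i0 u0us; apply=> [T i0T Tcl|j].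
    apply/setP => i; rewrite [RHS]inE.
    (* The chosen vertex of every component collapses to [u0], so each root's edge meets that of
       [i0]. *)
    have rT : fingraph.root e i \in T.
      apply: (Tcl i0) => //; apply/set0Pn; exists u0; rewrite inE u0i0 /=.
      by rewrite -[X in X \in _](piL _ (rootL i)) imset_f.
    have Tclosed : closed e (mem T).
      apply: (intro_closed csym) => a b /andP[_ /set0Pn[x /setIP[xa xb]]] aT.
      by apply: (Tcl a) => //; apply/set0Pn; exists (pi x); rewrite inE !imset_f.
    by have := closed_connect Tclosed (connect_root e i); rewrite /= => ->.
  have [/bigcupP[i _ jF]|jU] := boolP (j \in \bigcup_(i < r) F i).
    by exists i; apply: imset_f.
  by exists i0; have := piL j (outU j jU); rewrite /pi => ->.
have idI := @is_ideal_transversal K n r F.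
have mem_m f : f \in var_diffs K u0 us -> graded_max_ideal f.
  case/mapP=> v _ ->; apply: is_ideal_sub; first exact: is_ideal_gen.
    exact/var_ideal_mem/in_setT.
  exact/var_ideal_mem/in_setT.
have reg : quot_regular (@transversal_ideal K n r F) (var_diffs K u0 us).
  apply: (@var_diffs_regular K n r F u0 [::] us) => // [v vus|I1].
    by apply: sepL; rewrite inE vus orbT.
  (* The socle element lies outside the final ideal, which is therefore proper. *)
  have [g nIg _] := soc; have [_ _ JM] := is_ideal_adjs (var_diffs K u0 us) idI.
  by apply: nIg; rewrite -[g]mulr1; apply: JM.
have -> : (num_components F - 1 + n - #|\bigcup_(i < r) F i|)%N =
    size (var_diffs K u0 us).
  have Un := max_card (mem (\bigcup_(i < r) F i)); rewrite card_ord in Un.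
  have c0 : (0 < num_components F)%N.
    apply/card_gt0P; exists (fingraph.root e (Ordinal hr)).
    by rewrite !inE andbT; apply: roots_root.
  by rewrite size_map -addnBA // addnBAC // -sizeL subn1.
split; first by exists (var_diffs K u0 us).
move=> s ms regs; apply: (maximal_regular_depth idI _ reg soc) => // f.
  by move/mem_m; apply: linear.
by move/ms; apply: linear.
Qed.
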